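(* In the distributed file-bundle caching problem with $m=l+1$ identical caches, each of size $k$, and queries of length $l$, there is a deterministic online distributed caching algorithm with competitive ratio $l^2+l$ with respect to the optimal offline algorithm using a single cache of size $k$.
   Context: Pages $\mathcal{O}=\{1,\dots,N\}$. Distributed file-bundle caching: there are $m$ caches, the contents at time $t$ being $C_t=\{C_t^i\}_{i=1}^m$ with $C_t^i\subset\mathcal{O}$, $|C_t^i|=k$. At each time $t$ a query $Q_t\subset\mathcal{O}$ with $|Q_t|=l$ arrives; the cost is $f(C_t,Q_t)=\prod_{i=1}^m\mathbb{1}_{\{Q_t\not\subseteq C_t^i\}}$ (a miss occurs iff no single cache contains the whole query); the cache contents are updated between queries, without knowledge of future queries. The total cost on $\sigma=\{Q_t\}_{t=1}^T$ is $\mathrm{ALG}(\sigma)=\sum_t f(C_t,Q_t)$. The benchmark $\mathrm{OPT}(\sigma)$ is the number of misses of the optimal offline algorithm for the single-cache file-bundle caching problem with one cache of size $k$ (where a miss at time $t$ means $Q_t\not\subseteq C_t$, and upon a miss the cache must insert $Q_t$ by evicting pages, with no other changes allowed). Competitive ratio $r$: $\mathrm{ALG}(\sigma)\le r\,\mathrm{OPT}(\sigma)+c$ for all $\sigma$, with $c$ independent of $\sigma$. *)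

(* Defs.v *)
From mathcomp Require Import all_boot.

Set Implicit Arguments.
Unset Strict Implicit.
Unset Printing Implicit Defensive.

(* Pages are the elements of 'I_N; a query is a [bundle N l], the contents of a
   cache is a [bundle N k]. *)
Definition bundle (N j : nat) := {A : {set 'I_N} | #|A| == j}.

Definition config (N k m : nat) := {ffun 'I_m -> bundle N k}.

Definition config_cost (N k l m : nat) (C : config N k m) (Q : bundle N l) : nat :=
  \prod_(i < m) (~~ (val Q \subset val (C i)) : nat).

(* A deterministic online algorithm: from the queries seen so far (in order of
   arrival) to the contents of the caches when the next query arrives.  The
   initial contents are the value at [::]. *)
Definition online_alg (N k l m : nat) := seq (bundle N l) -> config N k m.

Definition alg_cost (N k l m : nat) (A : online_alg N k l m)
    (T : nat) (sigma : T.-tuple (bundle N l)) : nat :=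
  \sum_(t < T) config_cost (A (take t sigma)) (tnth sigma t).

(* One step of the single-cache problem: no change on a hit; on a miss, Q is
   inserted and pages are evicted so that k pages remain. *)
Definition single_step (N k l : nat) (C C' : bundle N k) (Q : bundle N l) : bool :=
  if val Q \subset val C then C' == C
  else (val Q \subset val C') && (val C' \subset val C :|: val Q).

(* [S t] is the contents of the cache just before query t (counted from 0), and
   [S T] the contents after the last query.  The initial contents are free. *)
Definition schedule (N k T : nat) := {ffun 'I_T.+1 -> bundle N k}.

Definition valid_schedule (N k l T : nat) (sigma : T.-tuple (bundle N l))
    (S : schedule N k T) : bool :=
  [forall t : 'I_T,
     single_step (S (widen_ord (leqnSn T) t)) (S (lift ord0 t)) (tnth sigma t)].

Definition schedule_misses (N k l T : nat) (sigma : T.-tuple (bundle N l))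
    (S : schedule N k T) : nat :=
  \sum_(t < T) ~~ (val (tnth sigma t) \subset val (S (widen_ord (leqnSn T) t))).

(* A schedule has at most T misses, so the default value T is the minimum only
   if every valid schedule misses every query, or if there is no valid schedule
   (which happens only for k < l or N < k). *)
Definition opt_cost (N k l T : nat) (sigma : T.-tuple (bundle N l)) : nat :=
  \big[minn/T]_(S : schedule N k T | valid_schedule sigma S)
     schedule_misses sigma S.

Definition competitive (N k l m : nat) (A : online_alg N k l m) (r : nat) : Prop :=
  exists c : nat, forall (T : nat) (sigma : T.-tuple (bundle N l)),
    alg_cost A sigma <= r * opt_cost k sigma + c.

(* Main.v *)
Require Import Defs.
From mathcomp Require Import all_boot zify.

Set Implicit Arguments.
Unset Strict Implicit.

(** Serve in phases: [P] is the set of pages requested in the current phase,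
    which ends when [P] would grow beyond [M = k + k %/ l] pages.  Set
    [d = #|P| - k <= k %/ l].  Since [l.+1 * d <= #|P|], one can choose [l.+1]
    disjoint groups of [d] pages of [P] and let cache [i] hold all of [P] but
    group [i].  A query inside [P] has only [l] pages, so it avoids one of the
    groups and is a hit.  Hence a phase costs at most [M] misses.  A single
    cache contains the first query of the phase once it has served it, and each
    of its misses brings in at most [l] pages, so it misses at least
    [(k %/ l).+1 / l] times before more than [M] pages have been requested.
    The ratio follows from [M <= l.+1 * (k %/ l).+1]. *)

(** * Covering a requested set by cache contents *)

(** The size condition sits under the existential so that every [A] gets a bundle, as choosing one
    for all groups at once requires. *)
Lemma bundle_superset (N k : nat) (A : {set 'I_N}) : k <= N ->
  exists B : bundle N k, #|A| <= k -> A \subset val B.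
Proof.
move=> hkN.
wlog hA : A / #|A| <= k.
  move=> ih; case: leqP => [leAk|_].
    by have [B hB] := ih A leAk; exists B => _; apply: hB.
  have [|B _] := ih set0; first by rewrite cards0.
  by exists B.
elim: {A}(k - #|A|) {-2}A (erefl (k - #|A|)) hA => [|n ih] A hn hA.
  have cA : #|A| == k by lia.
  by exists (exist _ A cA).
have /set0Pn[x xA] : ~: A != set0.
  by rewrite -card_gt0 cardsCs setCK card_ord; lia.
rewrite inE in xA.
have cxA : #|x |: A| = #|A|.+1 by rewrite cardsU1 xA.
have [||B hB] := ih (x |: A); try lia.
exists B => _; apply: subset_trans (hB _); last by lia.
exact: subsetUr.
Qed.

(* For [d = 0], [x %/ 0 = 0] puts all of [P] into group 0; the groups are still
   disjoint, which is all that is needed then. *)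
Definition page_group {N : nat} (P : {set 'I_N}) (d i : nat) : {set 'I_N} :=
  [set x in P | index x (enum P) %/ d == i].

(** The [d] entries of [enum P] from position [i * d] on have quotient [i]. *)
Lemma card_page_group (N : nat) (P : {set 'I_N}) (d i : nat) :
  i.+1 * d <= #|P| -> d <= #|page_group P d i|.
Proof.
move=> hi; set s := take d (drop (i * d) (enum P)).
have us : uniq s by rewrite take_uniq ?drop_uniq ?enum_uniq.
have cs : #|s| = d.
  rewrite (card_uniqP us) size_takel // size_drop -cardE.
  by move: hi; rewrite mulSn; lia.
rewrite -[X in X <= _]cs; apply/subset_leq_card/subsetP => x /(nthP x)[j].
rewrite size_take_min ltn_min => /andP[jd].
rewrite size_drop nth_take // nth_drop => hj <-.
have hlt : i * d + j < size (enum P) by rewrite -ltn_subRL.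
rewrite inE -mem_enum mem_nth //= index_uniq ?enum_uniq //.
by rewrite divnMDl ?divn_small ?addn0 //; lia.
Qed.

(** Pigeonhole: each page has a single quotient, so a query meeting all groups would have at least
    [l.+1] pages. *)
Lemma exists_missed_group (N l : nat) (P : {set 'I_N}) (d : nat)
    (Q : bundle N l) :
  exists i : 'I_l.+1, [disjoint val Q & page_group P d i].
Proof.
apply/existsP/contraT; rewrite negb_exists => /forallP hQ.
suff : l.+1 <= #|val Q| by rewrite (eqP (valP Q)) ltnn.
(* Quotients above [l] get a default value, which is harmless: only surjectivity of [f] is used. *)
pose f x : 'I_l.+1 := inord (index x (enum P) %/ d).
apply: leq_trans (leq_imset_card f (val Q)).
rewrite -[X in X <= _]card_ord -cardsT; apply/subset_leq_card/subsetP => i _.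
have /pred0Pn[x /andP[/= xQ]] := hQ i.
rewrite inE => /andP[_ /eqP xi]; apply/imsetP; exists x => //.
by rewrite /f xi inord_val.
Qed.

Definition phase_bound (k l : nat) := k + k %/ l.

Lemma covering_config (N k l : nat) : k <= N ->
  exists F : {set 'I_N} -> config N k l.+1,
    forall P : {set 'I_N}, #|P| <= phase_bound k l ->
      forall Q : bundle N l, val Q \subset P ->
        exists i, val Q \subset val (F P i).
Proof.
move=> hkN.
suff cover (P : {set 'I_N}) : exists C : config N k l.+1,
    #|P| <= phase_bound k l -> forall Q : bundle N l, val Q \subset P ->
      exists i, val Q \subset val (C i).
  by have [F hF] := fin_all_exists cover; exists F.
pose d := #|P| - k.
have [f hf] : exists f : 'I_l.+1 -> bundle N k, forall i : 'I_l.+1,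
    #|P :\: page_group P d i| <= k -> P :\: page_group P d i \subset val (f i).
  exact: fin_all_exists (fun i => bundle_superset _ hkN).
exists [ffun i => f i] => hP Q QP.
have [i dQ] := exists_missed_group P d Q.
exists i; rewrite ffunE; apply: subset_trans (hf i _).
  by rewrite subsetD QP.
have sG : page_group P d i \subset P.
  by apply/subsetP => x; rewrite inE => /andP[].
rewrite cardsD (setIidPr sG).
suff : d <= #|page_group P d i| by lia.
apply: card_page_group.
(* Here [l * d <= k], and [k + d = #|P|] unless [d = 0]. *)
apply: (@leq_trans (l.+1 * d)); first by rewrite leq_mul2r ltn_ord orbT.
have dq : d <= k %/ l by rewrite leq_subLR.
have ld : l * d <= k.
  by apply: leq_trans (leq_divM k l); rewrite mulnC leq_mul2r dq orbT.
have [Pk|/ltnW/subnK eP] := leqP #|P| k.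
  by rewrite /d (eqP Pk) muln0.
by rewrite mulSn -eP -/d leq_add2l.
Qed.

(** * Phases and the charging of misses *)

Definition mark {N l : nat} (k : nat) (P : {set 'I_N}) (Q : bundle N l) :=
  if #|P :|: val Q| <= phase_bound k l then P :|: val Q else val Q.

Definition marked {N l : nat} (k : nat) (s : seq (bundle N l)) : {set 'I_N} :=
  foldl (mark k) set0 s.

Lemma card_bundle (N j : nat) (B : bundle N j) : #|val B| = j.
Proof. exact/eqP/(valP B). Qed.

Lemma single_step_query (N k l : nat) (C C' : bundle N k) (Q : bundle N l) :
  single_step C C' Q -> val Q \subset val C'.
Proof. by rewrite /single_step; case: ifP => [QC /eqP ->|_ /andP[]]. Qed.

Lemma single_step_leq (N k l : nat) (C C' : bundle N k) (Q : bundle N l) :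
  single_step C C' Q -> l <= k.
Proof. by move/single_step_query/subset_leq_card; rewrite !card_bundle. Qed.

Lemma single_step_sub (N k l : nat) (C C' : bundle N k) (Q : bundle N l) :
  single_step C C' Q -> val C' \subset val C :|: val Q.
Proof.
rewrite /single_step; case: ifP => [_ /eqP ->|_ /andP[]] //.
exact: subsetUl.
Qed.

Lemma card_setU_query (N k l : nat) (P : {set 'I_N}) (C : bundle N k)
    (Q : bundle N l) :
  #|P :|: val C :|: val Q| <=
    #|P :|: val C| + l * ~~ (val Q \subset val C).
Proof.
case: (boolP (val Q \subset val C)) => QC /=.
  by rewrite -setUA (setUidPl QC) leq_addr.
by rewrite cardsU (card_bundle Q) muln1 leq_subr.
Qed.

(* [b] counts the misses of the single cache since it served the first query of
   the current phase; only the earlier misses have been paid for. *)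
Definition phase_invariant {N k l : nat} (alg opt : nat) (P : {set 'I_N})
    (C : bundle N k) : Prop :=
  #|P| <= phase_bound k l /\
  exists b, [/\ b <= opt, #|P :|: val C| <= k + l * b
    & alg <= (l ^ 2 + l) * (opt - b) + #|P|].

(** During a phase the misses of the algorithm are charged to [#|P|]; at its end the charge moves to
    the misses of the single cache. *)
Lemma phase_invariant_step (N k l alg opt miss : nat) (P : {set 'I_N})
    (C C' : bundle N k) (Q : bundle N l) :
  miss <= ~~ (val Q \subset P) -> single_step C C' Q ->
  phase_invariant (l := l) alg opt P C ->
  phase_invariant (l := l) (alg + miss)
    (opt + ~~ (val Q \subset val C)) (mark k P Q) C'.
Proof.
move=> hmiss hstep [hP [b [hb hPC halg]]].
have hlk := single_step_leq hstep.
have hgrow := card_setU_query P C Q.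
have hsub := single_step_sub hstep.
have hmul : l * (b + ~~ (val Q \subset val C)) =
    l * b + l * ~~ (val Q \subset val C) by rewrite mulnDr.
move: hgrow hmul; set o := (_ \subset val C); rewrite /mark => hgrow hmul.
case: leqP => hPQ; split => //.
- exists (b + ~~ o); split; first by rewrite leq_add2r.
  + rewrite hmul addnA; apply: leq_trans (leq_trans hgrow _); last first.
      by rewrite leq_add2r.
    apply/subset_leq_card/subsetP => x; rewrite !inE.
    by have := subsetP hsub x; rewrite !inE; do !case: (x \in _) => //=; apply.
  + rewrite subnDr.
    (* A miss requires a page outside [P], so the growth of [P] pays for it. *)
    suff : #|P| + miss <= #|P :|: val Q| by lia.
    move: hmiss; case: (boolP (val Q \subset P)) => [_|QP] /= hm.
      move: hm; rewrite leqn0 => /eqP ->; rewrite addn0.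
      exact/subset_leq_card/subsetUl.
    apply: leq_trans (leq_add (leqnn _) hm) _; rewrite addn1.
    apply: proper_card; rewrite properE subsetUl /=.
    by apply: contra QP => /(subset_trans (subsetUr _ _)).
- by rewrite card_bundle; apply: leq_trans hlk (leq_addr _ _).
- exists 0; split => //.
    by rewrite (setUidPr (single_step_query hstep)) card_bundle muln0 addn0.
  rewrite subn0 card_bundle.
  have hlarge : #|P :|: val Q| <= #|P :|: val C :|: val Q|.
    by apply/subset_leq_card/setSU/subsetUl.
  (* The query that ends a phase still counts for it: more than [k + k %/ l] pages are requested,
     all among the at most [k + l * (b + ~~ o)] pages of [P], [C] and [Q]. *)
  have hq : (k %/ l).+1 <= l * (b + ~~ o).
    rewrite hmul -(ltn_add2l k) addnA.
    apply: leq_trans (leq_trans hPQ hlarge) _.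
    by apply: leq_trans hgrow _; rewrite leq_add2r.
  have l_gt0 : 0 < l by case: (l) hq.
  have hk : k < (k %/ l).+1 * l by apply: ltn_ceil.
  have hm : miss <= 1 by apply: leq_trans hmiss (leq_b1 _).
  have -> : (l ^ 2 + l) * (opt + ~~ o) =
      (l ^ 2 + l) * (opt - b) + l.+1 * (l * (b + ~~ o)) by nia.
  (* By [hk], [phase_bound k l < l.+1 * (k %/ l).+1], which pays for the whole old phase. *)
  have : l.+1 * (k %/ l).+1 <= l.+1 * (l * (b + ~~ o)) by rewrite leq_mul2l hq.
  by rewrite /phase_bound in hP; nia.
Qed.

(** * Summation over the queries *)

Lemma sum_ord_ltS (T : nat) (F : 'I_T -> nat) (i : 'I_T) :
  \sum_(j < T | j < i.+1) F j = \sum_(j < T | j < i) F j + F i.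
Proof.
rewrite (bigD1 i) //= addnC; congr (_ + _); apply: eq_bigl => j.
by rewrite ltnS ltn_neqAle andbC.
Qed.

Lemma config_cost_leq1 (N k l m : nat) (C : config N k m) (Q : bundle N l) :
  config_cost C Q <= 1.
Proof.
rewrite /config_cost; elim/big_rec: _ => // i x _ hx.
by case: (_ \subset _); rewrite ?mul0n ?mul1n.
Qed.

Lemma config_cost_hit (N k l m : nat) (C : config N k m) (Q : bundle N l) i :
  val Q \subset val (C i) -> config_cost C Q = 0.
Proof. by move=> QC; rewrite /config_cost (bigD1 i) //= QC. Qed.

Lemma alg_cost_leq (N k l m : nat) (A : online_alg N k l m) (T : nat)
    (sigma : T.-tuple (bundle N l)) : alg_cost A sigma <= T.
Proof.
apply: leq_trans (leq_sum _ (fun t _ => config_cost_leq1 _ _)) _.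
by rewrite sum1_card card_ord.
Qed.

Lemma alg_cost_schedule (N k l m : nat) (F : {set 'I_N} -> config N k m)
    (hF : forall P : {set 'I_N}, #|P| <= phase_bound k l ->
      forall Q : bundle N l, val Q \subset P ->
        exists i, val Q \subset val (F P i))
    (T : nat) (sigma : T.-tuple (bundle N l)) (S : schedule N k T) :
  valid_schedule sigma S ->
  alg_cost (fun s => F (marked k s)) sigma <=
    (l ^ 2 + l) * schedule_misses sigma S + phase_bound k l.
Proof.
move=> /forallP hS.
pose cost (t : 'I_T) :=
  config_cost (F (marked k (take t sigma))) (tnth sigma t).
pose miss (t : 'I_T) : nat :=
  ~~ (val (tnth sigma t) \subset val (S (widen_ord (leqnSn T) t))).
suff inv t : t <= T -> phase_invariant (l := l) (\sum_(j < T | j < t) cost j)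
    (\sum_(j < T | j < t) miss j) (marked k (take t sigma)) (S (inord t)).
  have [hP [b [_ _ hcost]]] := inv T (leqnn T).
  have full G : \sum_(j < T | j < T) G j = \sum_(j < T) G j.
    by apply: eq_bigl => j; rewrite ltn_ord.
  (* The last phase may be unfinished; its [#|P|] gives the additive constant. *)
  rewrite !full in hcost; apply: leq_trans hcost _.
  by rewrite leq_add // leq_mul2l leq_subr orbT.
elim: t => [|t ih] hT.
  (* With nothing requested yet, any initial contents satisfy the invariant with [b = 0]. *)
  rewrite take0 !big_pred0 //; split; first by rewrite cards0.
  by exists 0; split=> //; rewrite set0U card_bundle leq_addr.
pose i := Ordinal hT.
have -> : take t.+1 sigma = rcons (take t sigma) (tnth sigma i).
  rewrite (take_nth (tnth sigma i)) ?size_tuple //.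
  by rewrite [in RHS](tnth_nth (tnth sigma i)).
rewrite /marked foldl_rcons -/(marked k (take t sigma)).
rewrite (sum_ord_ltS cost i) (sum_ord_ltS miss i).
have hw : widen_ord (leqnSn T) i = inord t.
  by apply: val_inj; rewrite /= inordK // ltnW.
have hl : lift ord0 i = inord t.+1 by apply: val_inj; rewrite /= inordK.
have hinv := ih (ltnW hT).
rewrite /miss hw; apply: (phase_invariant_step _ _ hinv); last first.
  by rewrite -hw -hl.
case: (boolP (_ \subset _)) => [Qsub|_] /=; last exact: config_cost_leq1.
by have [j hj] := hF _ hinv.1 _ Qsub; rewrite /cost (config_cost_hit hj).
Qed.

Unset Implicit Arguments.

Theorem theorem5p1 (N k l : nat) (hkN : k <= N) :
  exists A : online_alg N k l l.+1, competitive A (l ^ 2 + l).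
Proof.
have [F hF] := covering_config l hkN.
exists (fun s => F (marked k s)); exists (phase_bound k l) => T sigma.
rewrite /opt_cost; elim/big_ind: _ => [|x y hx hy|S /(alg_cost_schedule hF)] //.
  (* The default value [T] of the minimum: for [l = 0] the ratio is 0, but empty queries always hit;
     otherwise the ratio is positive and the cost is at most [T]. *)
  case: l F hF sigma => [|l] F hF sigma.
    rewrite /alg_cost big1 // => t _; apply: (config_cost_hit (i := ord0)).
    by have /cards0_eq -> := card_bundle (tnth sigma t); exact: sub0set.
  by have := alg_cost_leq (fun s => F (marked k s)) sigma; nia.
by rewrite /minn; case: ifP.
Qed.
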